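(* Let $G$ be a finite group with irreducible modules $G_\lambda$, $\lambda\in\Lambda(G)$, over $\mathbb{C}$, and let $V$ be a finite-dimensional $G$-module over $\mathbb{C}$. Let $A=(a_{\nu,\lambda})$ be the adjacency matrix of the McKay quiver of $(G,V)$. For $\lambda\in\Lambda(G)$ let $M^\lambda$ be the matrix $\mathrm{I}-tA^{\mathsf T}$ (with ${\mathsf T}$ denoting transpose) with the column indexed by $\lambda$ replaced by the column vector $\delta_0$ having entry $1$ in the row indexed by $0$ and $0$ in all other rows. Then the series $P^\lambda(t)=\sum_{k=0}^\infty (A^k)_{0,\lambda}\,t^k$ satisfies $$P^\lambda(t)=\frac{\det(M^\lambda)}{\det(\mathrm{I}-tA)}=\frac{\det(M^\lambda)}{\prod_{\mu\in\Lambda(G)}\bigl(1-\chi_V(c_\mu)t\bigr)}.$$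
   Context: $\Lambda(G)$ is a finite set indexing the irreducible complex $G$-modules up to isomorphism, and also the conjugacy classes of $G$; $0\in\Lambda(G)$ is the index of the trivial one-dimensional module, and it is taken to be the first element in the ordering of $\Lambda(G)$ used for rows and columns of matrices. $c_\mu$ is a representative of the conjugacy class labeled by $\mu\in\Lambda(G)$, and $\chi_V$ is the character of $V$. The McKay quiver of $(G,V)$ is the directed multigraph with node set $\Lambda(G)$ having $a_{\nu,\lambda}$ arrows from $\nu$ to $\lambda$, where $a_{\nu,\lambda}$ is the multiplicity of $G_\lambda$ in $G_\nu\otimes V$. Thus $(A^k)_{0,\lambda}$ is the number of walks of $k$ steps from $0$ to $\lambda$, equivalently the multiplicity of $G_\lambda$ in $V^{\otimes k}$. Identities are between formal power series in $t$. *)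

(* Defs.v *)
From HB Require Import structures.
From mathcomp Require Import all_boot all_order all_algebra all_fingroup.
From mathcomp Require Import mxrepresentation character.
From mathcomp Require Import boolp reals complex.

Set Implicit Arguments.
Unset Strict Implicit.
Unset Printing Implicit Defensive.

Import GRing.Theory.
Local Open Scope ring_scope.

(* Formal power series sum_k (fps_coef f k) t^k, with the Cauchy product. *)
Record fps (R : Type) := Fps { fps_coef : nat -> R }.

Lemma fpsP (R : Type) (f g : fps R) : fps_coef f =1 fps_coef g -> f = g.
Proof. by case: f g => [f] [g] /= /funext ->. Qed.

HB.instance Definition _ (R : Type) := gen_eqMixin (fps R).
HB.instance Definition _ (R : Type) := gen_choiceMixin (fps R).

Section FpsZmodule.
Variable R : zmodType.
Implicit Types f g h : fps R.

Definition fps_zero : fps R := Fps (fun=> 0).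
Definition fps_opp f := Fps (fun n => - fps_coef f n).
Definition fps_add f g := Fps (fun n => fps_coef f n + fps_coef g n).

Fact fps_addA : associative fps_add.
Proof. by move=> f g h; apply: fpsP => n /=; rewrite addrA. Qed.
Fact fps_addC : commutative fps_add.
Proof. by move=> f g; apply: fpsP => n /=; rewrite addrC. Qed.
Fact fps_add0 : left_id fps_zero fps_add.
Proof. by move=> f; apply: fpsP => n /=; rewrite add0r. Qed.
Fact fps_addN : left_inverse fps_zero fps_opp fps_add.
Proof. by move=> f; apply: fpsP => n /=; rewrite addNr. Qed.

HB.instance Definition _ :=
  GRing.isZmodule.Build (fps R) fps_addA fps_addC fps_add0 fps_addN.

Lemma fps_coef0 n : fps_coef (0 : fps R) n = 0. Proof. by []. Qed.
Lemma fps_coefN f n : fps_coef (- f) n = - fps_coef f n. Proof. by []. Qed.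
Lemma fps_coefD f g n : fps_coef (f + g) n = fps_coef f n + fps_coef g n.
Proof. by []. Qed.
Lemma fps_coefB f g n : fps_coef (f - g) n = fps_coef f n - fps_coef g n.
Proof. by []. Qed.
Lemma fps_coef_sum I (r : seq I) (P : pred I) (F : I -> fps R) n :
  fps_coef (\sum_(i <- r | P i) F i) n = \sum_(i <- r | P i) fps_coef (F i) n.
Proof. by apply: (big_morph (fun f => fps_coef f n)). Qed.

End FpsZmodule.

Section FpsRing.
Variable R : comNzRingType.
Implicit Types f g h : fps R.

Definition fpsC (a : R) : fps R := Fps (fun n => if n == 0%N then a else 0).
Definition fpsX : fps R := Fps (fun n => (n == 1%N)%:R).
Definition fps_mul f g : fps R :=
  Fps (fun n => \sum_(i < n.+1) fps_coef f i * fps_coef g (n - i)).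

Definition fps_trunc m f : {poly R} := \poly_(i < m.+1) fps_coef f i.

Lemma coef_fps_trunc m f i : (i <= m)%N -> (fps_trunc m f)`_i = fps_coef f i.
Proof. by rewrite coef_poly ltnS => ->. Qed.

Lemma fps_mul_poly f g (p q : {poly R}) n :
    (forall i, (i <= n)%N -> p`_i = fps_coef f i) ->
    (forall i, (i <= n)%N -> q`_i = fps_coef g i) ->
  fps_coef (fps_mul f g) n = (p * q)`_n.
Proof.
move=> pf qg; rewrite coefM; apply: eq_bigr => i _.
by rewrite pf ?qg ?leq_subr // -ltnS.
Qed.

Fact fps_mulA : associative fps_mul.
Proof.
move=> f g h; apply: fpsP => n.
pose T := fps_trunc n.
have E f' i : (i <= n)%N -> (T f')`_i = fps_coef f' i by apply: coef_fps_trunc.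
have M f' g' i : (i <= n)%N -> (T f' * T g')`_i = fps_coef (fps_mul f' g') i.
  by move=> le_in; symmetry; apply: fps_mul_poly => j le_ji;
    apply: E (leq_trans le_ji le_in).
rewrite (@fps_mul_poly f _ (T f) (T g * T h)); [|exact: E|exact: M].
by rewrite (@fps_mul_poly _ h (T f * T g) (T h)) ?mulrA; [|exact: M|exact: E].
Qed.

Fact fps_mulC : commutative fps_mul.
Proof.
move=> f g; apply: fpsP => n.
rewrite (@fps_mul_poly f g _ _ n (@coef_fps_trunc n f) (@coef_fps_trunc n g)).
by rewrite mulrC -(fps_mul_poly (@coef_fps_trunc n g) (@coef_fps_trunc n f)).
Qed.

Fact fps_mul1 : left_id (fpsC 1) fps_mul.
Proof.
move=> f; apply: fpsP => n /=; rewrite big_ord_recl /= mul1r subn0.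
by rewrite big1 ?addr0 // => i _; rewrite mul0r.
Qed.

Fact fps_mulDl : left_distributive fps_mul +%R.
Proof.
move=> f g h; apply: fpsP => n; rewrite fps_coefD /= -big_split.
by apply: eq_bigr => i _; rewrite mulrDl.
Qed.

Fact fps_one_neq0 : fpsC 1 != 0.
Proof.
by apply/eqP => /(congr1 (fun f => fps_coef f 0)) /eqP; rewrite /= oner_eq0.
Qed.

HB.instance Definition _ := GRing.Zmodule_isComNzRing.Build (fps R)
  fps_mulA fps_mulC fps_mul1 fps_mulDl fps_one_neq0.

Lemma fps_coef1 n : fps_coef (1 : fps R) n = (n == 0%N)%:R.
Proof. by case: n. Qed.
Lemma fps_coefM f g n :
  fps_coef (f * g) n = \sum_(i < n.+1) fps_coef f i * fps_coef g (n - i).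
Proof. by []. Qed.

Lemma fps_coefM0 f g : fps_coef (f * g) 0 = fps_coef f 0 * fps_coef g 0.
Proof. by rewrite fps_coefM big_ord1. Qed.

Lemma fps_coefCM a f n : fps_coef (fpsC a * f) n = a * fps_coef f n.
Proof.
rewrite fps_coefM big_ord_recl /= subn0 big1 ?addr0 // => i _.
by rewrite mul0r.
Qed.

Lemma fps_coefX_lt f k n :
  fps_coef f 0 = 0 -> (n < k)%N -> fps_coef (f ^+ k) n = 0.
Proof.
move=> f0; elim: k n => // k IHk n; rewrite ltnS => le_nk.
rewrite exprS fps_coefM big_ord_recl f0 mul0r add0r big1 // => i _.
rewrite IHk ?mulr0 // lift0; apply: leq_trans le_nk.
by rewrite ltn_subrL (leq_ltn_trans _ (ltn_ord i)).
Qed.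

End FpsRing.

Section FpsUnitRing.
Variable R : comUnitRingType.
Implicit Types f g h : fps R.

Definition fps_unit f := fps_coef f 0 \is a GRing.unit.

(* With f 0 = a a unit and h = 1 - a^-1 f, this is a^-1 (1 + h + h^2 + ...);
   powers of h beyond the n-th do not contribute to the n-th coefficient. *)
Definition fps_inv f : fps R :=
  if fps_unit f then
    let a := (fps_coef f 0)^-1 in
    Fps (fun n => a * fps_coef (\sum_(k < n.+1) (1 - fpsC a * f) ^+ k) n)
  else f.

Fact fps_mulVr : {in fps_unit, left_inverse 1 fps_inv *%R}.
Proof.
move=> f uf; rewrite /fps_inv ifT //; set a := _^-1.
set h := 1 - _.
have h0 : fps_coef h 0 = 0.
  by rewrite fps_coefB fps_coef1 fps_coefCM mulVr ?subrr.
set S := Fps _; apply: fpsP => n.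
pose Q := \sum_(k < n.+1) h ^+ k.
have SQ i : (i <= n)%N -> fps_coef S i = a * fps_coef Q i.
  move=> le_in; rewrite /S /= /Q !fps_coef_sum; congr (_ * _).
  rewrite (big_ord_widen n.+1 (fun k => fps_coef (h ^+ k) i)) //.
  rewrite [RHS](bigID (fun k : 'I_n.+1 => (k < i.+1)%N)) /= [X in _ + X]big1.
    by rewrite addr0.
  by move=> k; rewrite -leqNgt => /(fps_coefX_lt h0).
have -> : fps_coef (S * f) n = fps_coef (Q * (1 - h)) n.
  rewrite /h opprB addrC subrK mulrCA fps_coefCM !fps_coefM mulr_sumr.
  by apply: eq_bigr => i _; rewrite SQ -1?ltnS // mulrA.
have -> : Q * (1 - h) = 1 - h ^+ n.+1.
  by rewrite mulrC -[1 in RHS](expr1n _ n.+1) subrXX; congr (_ * _);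
    apply: eq_bigr => k _; rewrite expr1n mul1r.
by rewrite fps_coefB (fps_coefX_lt h0) // subr0.
Qed.

Fact fps_unitPl f g : g * f = 1 -> fps_unit f.
Proof.
move=> /(congr1 (fun h => fps_coef h 0)); rewrite fps_coefM0 fps_coef1 => fg1.
by apply/unitrPr; exists (fps_coef g 0); rewrite mulrC.
Qed.

Fact fps_inv_out : {in [predC fps_unit], fps_inv =1 id}.
Proof. by move=> f; rewrite inE /fps_inv => /negPf nuf; rewrite ifF. Qed.

HB.instance Definition _ := GRing.ComNzRing_hasMulInverse.Build (fps R)
  fps_mulVr fps_unitPl fps_inv_out.

End FpsUnitRing.

Section McKay.
Variables (F : fieldType) (gT : finGroupType) (G : {group gT}) (n : nat).

Definition trivial_repr (W : representation F G) :=
  rdegree W = 1%N /\ forall g, g \in G -> W g = 1%:M.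

Definition irr_family (S : 'I_n.+1 -> representation F G) :=
  [/\ forall i, mx_irreducible (S i),
      forall i j, mx_rsim (S i) (S j) -> i = j,
      forall W : representation F G,
        mx_irreducible W -> exists i, mx_rsim W (S i)
    & trivial_repr (S ord0)].

Definition class_reps (c : 'I_n.+1 -> gT) :=
  (forall i, c i \in G) /\
  (forall g, g \in G -> exists! i, g \in (c i ^: G)%g).

(* Over the complex numbers any module splits as a direct sum of the
   irreducible modules S lambda, with uniquely determined multiplicities
   (Maschke and Krull-Schmidt), so exactly one A satisfies this: A nu lambda
   is the multiplicity of S lambda in the tensor product of S nu and V. *)
Definition mckay_adjacency (S : 'I_n.+1 -> representation F G)
    (V : representation F G) (A : 'M[nat]_n.+1) :=
  forall nu, mx_rsim (prod_repr (S nu) V)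
    (\big[@dadd_grepr F gT G/@grepr0 F gT G]_lambda
        muln_grepr (S lambda) (A nu lambda)).

End McKay.

Section WalkSeries.
Variables (R : comNzRingType) (n : nat) (A : 'M[nat]_n.+1).
Local Notation t := (fpsX R).

Definition adj_fps : 'M[fps R]_n.+1 := map_mx (fun a => a%:R) A.

Definition walk_series (lambda : 'I_n.+1) : fps R :=
  Fps (fun k => ((A ^+ k) ord0 lambda)%:R).

Definition mckay_M (lambda : 'I_n.+1) : 'M[fps R]_n.+1 :=
  \matrix_(i, j) if j == lambda then (i == ord0)%:R
                 else (1%:M - t *: adj_fps^T) i j.

End WalkSeries.

(* Main.v *)
(** The traces of the [G_lambda] at the [c_mu] form an invertible matrix [X]
    (the character table): the central idempotents of the group algebra show
    that irreducible characters are linearly independent, and characters are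
    determined by their values on the [c_mu].  Comparing traces in the
    decomposition of [G_nu (x) V] gives [A X = X D] with [D] the diagonal matrix
    of the [chi_V(c_mu)], so [det(I - tA)] is the product of the
    [1 - chi_V(c_mu) t], which is a unit.  The walk series satisfy
    [(I - t A^T) P = delta_0], and Cramer's rule gives the first equality. *)
Require Import Defs.
From HB Require Import structures.
From mathcomp Require Import all_boot all_order all_algebra all_fingroup.
From mathcomp Require Import pgroup mxrepresentation character.
From mathcomp Require Import reals complex.
Import GRing.Theory.
Local Open Scope ring_scope.

Set Implicit Arguments.
Unset Strict Implicit.
Unset Printing Implicit Defensive.

(** Deleting column [l] removes all differences between [M] and [B], so they share the cofactors of
    that column. Expanding [\det M] there gives entry [l] of [\adj B *m b = \adj B *m B *m x]. *)
Lemma cramer_col (R : comNzRingType) (n : nat) (B M : 'M[R]_n)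
    (x b : 'cV[R]_n) (l : 'I_n) :
    B *m x = b -> (forall i, M i l = b i ord0) ->
    (forall i j, j != l -> M i j = B i j) ->
  \det M = x l ord0 * \det B.
Proof.
move=> Bx Ml Mj; rewrite (expand_det_col M l).
transitivity ((\adj B *m b) l ord0); last first.
  by rewrite -Bx mulmxA mul_adj_mx mul_scalar_mx mxE mulrC.
rewrite mxE; apply: eq_bigr => i _; rewrite Ml mulrC; congr (_ * _).
rewrite mxE /cofactor; congr (_ * \det _).
by apply/matrixP=> r s; rewrite !mxE Mj // eq_sym neq_lift.
Qed.

Section FpsConst.
Variable R : comNzRingType.

(** The morphism structure on [fpsC] lets matrix identities, determinants and units over [R] be
    carried to power series. *)
Fact fpsC_is_zmod_morphism : zmod_morphism (@fpsC R).
Proof. by move=> a b; apply: fpsP => -[|k]; rewrite fps_coefB //= subr0. Qed.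

Fact fpsC_is_monoid_morphism : monoid_morphism (@fpsC R).
Proof.
split=> // a b; apply: fpsP => k; rewrite fps_coefCM /=.
by case: k => [|k] //=; rewrite mulr0.
Qed.

HB.instance Definition _ :=
  GRing.isZmodMorphism.Build R (fps R) (@fpsC R) fpsC_is_zmod_morphism.
HB.instance Definition _ :=
  GRing.isMonoidMorphism.Build R (fps R) (@fpsC R) fpsC_is_monoid_morphism.

Lemma fps_coef_mulX (f : fps R) (k : nat) :
  fps_coef (fpsX R * f) k = if k is k'.+1 then fps_coef f k' else 0.
Proof.
rewrite fps_coefM big_ord_recl /= mul0r add0r.
case: k => [|k]; first by rewrite big_ord0.
rewrite big_ord_recl /= mul1r subSS subn0 big1 ?addr0 // => i _.
by rewrite mul0r.
Qed.

Lemma fps_coef_natM (a : nat) (f : fps R) (k : nat) :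
  fps_coef (a%:R * f) k = a%:R * fps_coef f k.
Proof. by rewrite -(rmorph_nat (@fpsC R)) fps_coefCM. Qed.

(** In degree [k.+1] this is the recursion [A ^+ k.+1 = A ^+ k * A], splitting off the last arrow of
    a walk; in degree 0 it is the empty walk at [ord0]. *)
Lemma walk_series_eq (n : nat) (A : 'M[nat]_n.+1) :
  (1%:M - fpsX R *: (adj_fps R A)^T) *m (\col_l walk_series R A l)
    = \col_i (i == ord0)%:R.
Proof.
apply/matrixP=> i j; rewrite mulmxBl mul1mx -scalemxAl !mxE; apply: fpsP => k.
rewrite fps_coefB fps_coef_mulX /=.
have -> : fps_coef ((i == ord0)%:R : fps R) k
    = ((i == ord0) && (k == 0%N))%:R.
  by case: (i == ord0); rewrite ?fps_coef1 ?fps_coef0.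
case: k => [|k]; first by rewrite subr0 expr0 mxE andbT eq_sym natn.
rewrite andbF fps_coef_sum exprSr mxE natr_sum -sumrB big1 // => l _.
by rewrite !mxE fps_coef_natM /= natrM mulrC subrr.
Qed.

Lemma det_mckay_M (n : nat) (A : 'M[nat]_n.+1) (l : 'I_n.+1) :
  \det (mckay_M R A l)
    = walk_series R A l * \det (1%:M - fpsX R *: adj_fps R A).
Proof.
have tr1BtA : (1%:M - fpsX R *: adj_fps R A)^T
    = 1%:M - fpsX R *: (adj_fps R A)^T.
  by apply/matrixP=> i j; rewrite !mxE eq_sym.
(* The linear system involves the transpose of [A], the denominator [A] itself. *)
rewrite -[in RHS]det_tr tr1BtA.
rewrite (cramer_col (M := mckay_M R A l) (l := l) (walk_series_eq A)).
- by rewrite mxE.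
- by move=> i; rewrite !mxE eqxx.
- by move=> i j /negbTE ne_j; rewrite mxE ne_j.
Qed.

End FpsConst.

Lemma fps_unit_1BCX (R : comUnitRingType) (a : R) :
  1 - fpsC a * fpsX R \is a GRing.unit.
Proof.
rewrite /in_mem /= /GRing.unit_subdef /= /fps_unit.
by rewrite fps_coefB fps_coefCM fps_coef1 /= mulr0 subr0 unitr1.
Qed.

(** With [D = diag_mx d], the hypothesis gives [(I - tA) X = X (I - tD)]; take determinants and
    cancel [\det X], a unit constant series. *)
Lemma det_1BtA_diag (R : comUnitRingType) (n : nat) (A : 'M[nat]_n.+1)
    (X : 'M[R]_n.+1) (d : 'rV[R]_n.+1) :
    X \in unitmx ->
    map_mx (fun a : nat => a%:R) A *m X = X *m diag_mx d ->
  \det (1%:M - fpsX R *: adj_fps R A)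
    = \prod_(mu < n.+1) (1 - fpsC (d ord0 mu) * fpsX R).
Proof.
move=> uX AX; pose f : {rmorphism R -> fps R} := @fpsC R.
have uX' : \det (map_mx f X) \is a GRing.unit by rewrite det_map_mx rmorph_unit.
apply: (mulIr uX'); rewrite -det_mulmx mulmxBl mul1mx -scalemxAl.
have -> : adj_fps R A = map_mx f (map_mx (fun a : nat => a%:R) A).
  by apply/matrixP=> i j; rewrite !mxE /= -[RHS]/(f _) rmorph_nat.
rewrite -map_mxM AX map_mxM map_diag_mx.
have -> : map_mx f X - fpsX R *: (map_mx f X *m diag_mx (map_mx f d))
    = map_mx f X *m diag_mx (\row_mu (1 - f (d ord0 mu) * fpsX R)).
  apply/matrixP=> i j; rewrite !mul_mx_diag !mxE mulrBr mulr1.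
  by congr (_ - _); rewrite mulrC mulrA.
rewrite det_mulmx det_diag mulrC; congr (_ * _).
by apply: eq_bigr => mu _; rewrite mxE.
Qed.

Section Traces.
Variables (F : fieldType) (gT : finGroupType) (G : {group gT}).
Local Notation reprG := (representation F G).

Lemma mxtrace_dsum_grepr I (r : seq I) (P : pred I) (W : I -> reprG) g :
  \tr ((\big[@dadd_grepr F gT G/@grepr0 F gT G]_(i <- r | P i) W i) g)
    = \sum_(i <- r | P i) \tr (W i g).
Proof.
apply: (big_morph (fun W : reprG => \tr (W g))) => [U U'|].
  by rewrite mxtrace_block.
by rewrite /= mxtrace1.
Qed.

Lemma mxtrace_muln_grepr (W : reprG) k g :
  \tr (muln_grepr W k g) = k%:R * \tr (W g).
Proof. by rewrite mxtrace_dsum_grepr sumr_const card_ord mulr_natl. Qed.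

Lemma mckay_adjacency_trace n (S : 'I_n.+1 -> reprG) (V : reprG) A g nu :
    mckay_adjacency S V A -> g \in G ->
  \sum_l (A nu l)%:R * \tr (S l g) = \tr (S nu g) * \tr (V g).
Proof.
move=> hA Gg; rewrite -mxtrace_prod.
rewrite [RHS](mxtrace_rsim (hA nu) Gg) mxtrace_dsum_grepr.
by apply: eq_bigr => l _; rewrite mxtrace_muln_grepr.
Qed.

Lemma mxtrace_gring_op n (rG : mx_representation F G n) B :
  \tr (gring_op rG B)
    = \sum_(j < #|G|) gring_row B ord0 j * \tr (rG (enum_val j)).
Proof.
rewrite gring_opE /gring_mx /= mulmx_sum_row !linear_sum /=.
by apply: eq_bigr => j _; rewrite linearZ /= rowK mxvecK mxtraceZ.
Qed.

Lemma mxtrace_class n (rG : mx_representation F G n) x g :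
  x \in G -> g \in (x ^: G)%g -> \tr (rG g) = \tr (rG x).
Proof.
move=> Gx /imsetP[y Gy ->].
by rewrite !repr_mxM ?groupM ?groupV // mxtrace_mulC repr_mxK.
Qed.

Hypothesis charF0 : [pchar F] =i pred0.

(** The relation extends linearly to the group algebra. At the central idempotent [e] of the
    component of [S i], it reduces to [a i] times the degree of [S i]. *)
Lemma irr_traces_free (sG : irrType F G) n (S : 'I_n -> reprG)
    (a : 'I_n -> F) :
    (forall i, mx_irreducible (S i)) ->
    (forall i j, mx_rsim (S i) (S j) -> i = j) ->
    (forall g, g \in G -> \sum_i a i * \tr (S i g) = 0) ->
  forall i, a i = 0.
Proof.
move=> irrS simS sum0 i.
(* This is the condition of Maschke's theorem. *)
have F'G : ([pchar F]^'.-group G)%g.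
  by apply/pgroupP=> p _ _; rewrite inE /= charF0.
pose s j := irr_comp sG (S j).
have s_inj j : s j = s i -> j = i.
  move=> sji; apply: simS.
  apply: mx_rsim_trans (rsim_irr_comp_pchar sG F'G (irrS j)) _.
  rewrite -/(s j) sji; apply: mx_rsim_sym.
  exact: rsim_irr_comp_pchar.
pose e := Wedderburn_id (s i).
have opE j : gring_op (S j) e = if j == i then 1%:M else 0.
  case: eqP => [->|ne_ji].
    rewrite -(gring_op1 (S i)) -(Wedderburn_sum_id_pchar sG F'G) linear_sum.
    (* The Wedderburn idempotents sum to 1, and those of the other components act as 0 on [S i]. *)
    rewrite (bigD1 (s i)) //= [X in _ + X]big1 ?addr0 // => k ne_k.
    exact: irr_comp'_op0_pchar ne_k (Wedderburn_id_mem _).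
  apply: (irr_comp'_op0_pchar F'G (irrS j)) (Wedderburn_id_mem _).
  by apply/eqP=> sij; apply: ne_ji; apply: s_inj.
have : \sum_j a j * \tr (gring_op (S j) e) = 0.
  under eq_bigr => j _ do rewrite mxtrace_gring_op mulr_sumr.
  rewrite exchange_big big1 //= => x _.
  transitivity (gring_row e ord0 x * \sum_j a j * \tr (S j (enum_val x))).
    by rewrite mulr_sumr; apply: eq_bigr => j _; rewrite mulrCA.
  by rewrite sum0 ?mulr0 ?enum_valP.
rewrite (bigD1 i) //= big1 => [|j ne_ji]; last first.
  by rewrite opE (negbTE ne_ji) linear0 mulr0.
rewrite addr0 opE eqxx mxtrace1 => /eqP.
rewrite mulf_eq0 => /orP[/eqP //|].
(* The degree is positive, hence nonzero in [F]. *)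
have /mx_irrP[n_gt0 _] := irrS i.
by rewrite ((pcharf0P F).1 charF0) eqn0Ngt n_gt0.
Qed.

Lemma character_table_unit (sG : irrType F G) n (S : 'I_n.+1 -> reprG)
    (c : 'I_n.+1 -> gT) :
    irr_family S -> class_reps G c ->
  (\matrix_(l, mu) \tr (S l (c mu)) : 'M[F]_n.+1) \in unitmx.
Proof.
move=> [irrS simS _ _] [Gc classc]; rewrite -row_free_unit.
(* A row vector killed by the table is a relation between characters at the [c mu], hence on all of
   [G]. *)
apply: inj_row_free => v vX0; apply/rowP=> i; rewrite mxE.
apply: (irr_traces_free sG (a := fun l => v ord0 l) irrS simS) => g Gg.
have [mu [gmu _]] := classc g Gg.
transitivity ((v *m (\matrix_(l, mu) \tr (S l (c mu)))) ord0 mu); last first.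
  by rewrite vX0 mxE.
by rewrite mxE; apply: eq_bigr => l _; rewrite mxE (mxtrace_class _ (Gc mu) gmu).
Qed.

End Traces.

Theorem theorem1p12 (R : realType) (gT : finGroupType) (G : {group gT})
    (n : nat) (Gmod : 'I_n.+1 -> representation (complex R) G)
    (c : 'I_n.+1 -> gT) (V : representation (complex R) G)
    (A : 'M[nat]_n.+1)
    (hS : irr_family Gmod) (hc : class_reps G c) (hA : mckay_adjacency Gmod V A)
    (lambda : 'I_n.+1) :
  walk_series (complex R) A lambda
    = \det (mckay_M (complex R) A lambda)
      / \det (1%:M - fpsX (complex R) *: adj_fps (complex R) A)
  /\
  \det (mckay_M (complex R) A lambda)
      / \det (1%:M - fpsX (complex R) *: adj_fps (complex R) A)
    = \det (mckay_M (complex R) A lambda)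
      / \prod_(mu < n.+1) (1 - fpsC (\tr (V (c mu))) * fpsX (complex R)).
Proof.
(* Every irreducible type occurs in the socle of the regular module. *)
have sG : irrType (complex R) G := DecSocleType (regular_repr (complex R) G).
have uX := character_table_unit (Num.Theory.pchar_num _) sG hS hc.
have detA : \det (1%:M - fpsX (complex R) *: adj_fps (complex R) A)
    = \prod_(mu < n.+1) (1 - fpsC (\tr (V (c mu))) * fpsX (complex R)).
  rewrite (@det_1BtA_diag _ _ _ _ (\row_mu \tr (V (c mu))) uX).
    by apply: eq_bigr => mu _; rewrite mxE.
  apply/matrixP=> nu mu; rewrite mul_mx_diag !mxE.
  rewrite -(mckay_adjacency_trace _ hA (hc.1 mu)).
  by apply: eq_bigr => l _; rewrite !mxE.
split; last by rewrite detA.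
(* Inversion fixes non-units by default, so the quotient is a true one only once this is known. *)
have uA : \det (1%:M - fpsX (complex R) *: adj_fps (complex R) A)
    \is a GRing.unit.
  by rewrite detA; apply: rpred_prod => mu _; apply: fps_unit_1BCX.
by rewrite det_mckay_M mulrK.
Qed.
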